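(* Let $\Phi(\cdot,\cdot)\ge0$, $\phi(\cdot)\ge0$ be a general spatially invariant pairwise interaction and vertex potential on a finite spin set (where $\Phi$ need not be positively alignable, i.e. there need not exist a non-negative vector $\alpha$ with $\Phi\alpha=[1\,\dots\,1]^T$). For every positive integer $b$, if the infinite regular tree $\hat{\mathbb{T}}^b$ of degree $b+1$, with the extra permissive spin $\sigma_0$ added to the spin set, exhibits very strong spatial mixing with rate $\delta$, then every finite graph with maximum degree $b+1$ and having the same $\Phi(\cdot,\cdot)$, $\phi(\cdot)$ (on the original spin set) exhibits strong spatial mixing with rate $\delta$.
   Context: **Spin system.** $X=\{\sigma_1,\dots,\sigma_q\}$ is a finite spin set with a fixed reference spin $\sigma_q$; $\Phi:X\times X\to[0,\infty)$ is symmetric and $\phi:X\to[0,\infty)$. On a finite graph $G=(V,E)$ the Gibbs measure gives $\vec x\in X^V$ probability proportional to $\prod_{\{i,j\}\in E}\Phi(x_i,x_j)\prod_{i\in V}\phi(x_i)$ (the same $\Phi,\phi$ at all edges and vertices). $p(v=\sigma\mid X_\Lambda=\sigma_\Lambda)$ is the marginal at $v$ given that the vertices of $\Lambda$ are frozen to $\sigma_\Lambda\in X^\Lambda$. **Extra spin.** $\sigma_0\notin X$ is an additional (permissive) spin, with $\Phi(\sigma_0,\sigma_l)=\Phi(\sigma_l,\sigma_0)=c_2>0$ for all spins $\sigma_l$ and $\phi(\sigma_0)=c_3>0$. The tree with the extra spin is the tree carrying the spin system with the enlarged spin set $X_0=X\cup\{\sigma_0\}$ and the so extended $\Phi,\phi$.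 **Rates.** $\delta:\mathbb{N}\to\mathbb{R}^+$ is a function tending to $0$ at infinity. **Strong spatial mixing.** The spin system on $G=(V,E)$ exhibits strong spatial mixing with rate $\delta$ if and only if for every spin $\sigma_1\in X$, every $v\in V$, every $\Lambda\subseteq V$ and any two configurations $\sigma_\Lambda,\tau_\Lambda\in X^\Lambda$, $$|p(v=\sigma_1\mid X_\Lambda=\sigma_\Lambda)-p(v=\sigma_1\mid X_\Lambda=\tau_\Lambda)|\le\delta(\mathrm{dist}(v,\Delta)),$$ where $\Delta\subseteq\Lambda$ is the set on which $\sigma_\Lambda$ and $\tau_\Lambda$ differ. **The tree.** $\hat{\mathbb{T}}^b$ is the infinite tree in which every vertex has degree $b+1$, rooted at a vertex $v$. **Valid coupling lines.** On a rooted tree, a coupling line is a virtual edge joining a vertex (top endpoint) to a vertex in the subtree below it (lower endpoint). A set of coupling lines is valid if the lower endpoints are all distinct and no two coupling lines form a nested or interleaved pair, i.e. the endpoints of two coupling lines do not lie on a single path descending from the root. **Computation with coupling lines (spin set $X_0$).** For a node $w$ let $B(w)$ be the set of lower endpoints of coupling lines with top endpoint $w$. For a partial assignment $\eta$ of spins in $X_0$ to nodes, define $R_w^\eta(s)$ for every $s\in X_0$: if $w$ is frozen by $\eta$, then $R_w^\eta(s)=1$ for $s=\eta(w)$ and $0$ otherwise; if $w$ is not frozen, let $\eta_s$ be $\eta$ extended by freezing every not yet frozen node of $B(w)$ to $s$, and $$R_w^\eta(s)=\frac{\phi(s)}{\phi(\sigma_q)}\prod_{u\text{ child of }w}\frac{\sum_{l=0}^q\Phi(s,\sigma_l)R_u^{\eta_s}(\sigma_l)}{\sum_{l=0}^q\Phi(\sigma_q,\sigma_l)R_u^{\eta_s}(\sigma_l)}.$$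 For a frozen set $\Lambda$ with configuration $\sigma_\Lambda$, the marginal at the root $v$ is $p_T(v=\sigma_1\mid X_\Lambda=\sigma_\Lambda)=R_v^{\sigma_\Lambda}(\sigma_1)/\sum_{l=0}^q R_v^{\sigma_\Lambda}(\sigma_l)$. The tree may be pruned below any frozen node and below any lower endpoint of a coupling line; the computation is considered when the pruned tree is finite, so that the recursion terminates. **Very strong spatial mixing.** The rooted tree $T$ with root $v$ (here $\hat{\mathbb{T}}^b$ with spin set $X_0$) exhibits very strong spatial mixing with rate $\delta$ if and only if for every spin $\sigma_1\in X_0$, every set of valid coupling lines, every set $\Lambda$ of nodes, and any two configurations $\sigma_\Lambda,\tau_\Lambda\in X_0^\Lambda$ on the frozen nodes, $$|p_T(v=\sigma_1\mid X_\Lambda=\sigma_\Lambda)-p_T(v=\sigma_1\mid X_\Lambda=\tau_\Lambda)|\le\delta(\mathrm{dist}(v,\Delta)),$$ where $\Delta\subseteq\Lambda$ is the set on which they differ and the marginals are computed by the recursion with the given set of coupling lines.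
   Formalization: Very strong spatial mixing is assumed for every weight c_3>0 of the extra spin with one rate (c_2 fixed), since for one fixed large c_3 the claim fails; zero reference denominators in the recursion are dropped; only frozen configurations of positive probability are compared in the graph. *)

(* Defs.v *)
(* World: MathComp + MathComp-Analysis. *)
From HB Require Import structures.
From mathcomp Require Import all_boot all_order all_algebra.
From mathcomp Require Import all_classical all_reals all_analysis.

Set Implicit Arguments.
Unset Strict Implicit.
Unset Printing Implicit Defensive.

Import Order.TTheory GRing.Theory Num.Theory numFieldNormedType.Exports.

Local Open Scope classical_set_scope.
Local Open Scope ring_scope.

(* ---------- Rates and distances ---------- *)

Definition is_rate (R : realType) (delta : nat -> R) : Prop :=
  (forall n, 0 <= delta n) /\ (delta @ \oo --> (0 : R)).

(* [at_dist n] says that the set under consideration has a point reached in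
   [n] steps; the distance to the set is the least such [n], and [None] stands
   for an infinite distance (empty or unreachable set). *)
Definition is_dist (at_dist : nat -> Prop) (d : option nat) : Prop :=
  if d is Some n then at_dist n /\ (forall m, (m < n)%N -> ~ at_dist m)
  else forall n, ~ at_dist n.

(* A rate vanishes at infinity. *)
Definition rate_at (R : realType) (delta : nat -> R) (d : option nat) : R :=
  if d is Some n then delta n else 0.

(* ---------- Spin systems on finite simple graphs ---------- *)

Section Graph.
Variables (R : realType) (X V : finType) (e : rel V).
Variables (Phi : X -> X -> R) (phi : X -> R).

Definition maxdeg : nat := \max_(x : V) #|[set y | e x y]%SET|.

(* Each edge {i, j} is counted once, through its increasing orientation. *)
Definition weight (x : {ffun V -> X}) : R :=
  (\prod_(p : V * V | e p.1 p.2 && (enum_rank p.1 < enum_rank p.2)%N)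
     Phi (x p.1) (x p.2)) * \prod_(i : V) phi (x i).

Definition gibbs (x : {ffun V -> X}) : R :=
  weight x / \sum_(y : {ffun V -> X}) weight y.

Definition gibbs_prob (P : pred {ffun V -> X}) : R :=
  \sum_(x : {ffun V -> X} | P x) gibbs x.

(* A configuration on Lambda is the restriction to Lambda of a total one. *)
Definition agree (Lambda : {set V}) (sigma : {ffun V -> X}) :
    pred {ffun V -> X} :=
  fun x => [forall i in Lambda, x i == sigma i].

Definition graph_marginal (v : V) (s : X)
    (Lambda : {set V}) (sigma : {ffun V -> X}) : R :=
  gibbs_prob (fun x => agree Lambda sigma x && (x v == s)) /
  gibbs_prob (agree Lambda sigma).

(* The conditional marginals exist only when the conditioning events have
   positive probability, which can fail in the presence of hard constraints. *)
Definition ssm (delta : nat -> R) : Prop :=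
  forall (s : X) (v : V) (Lambda : {set V}) (sigma tau : {ffun V -> X})
         (d : option nat),
    0 < gibbs_prob (agree Lambda sigma) ->
    0 < gibbs_prob (agree Lambda tau) ->
    is_dist (fun n => exists p : seq V,
        [/\ path e v p, size p = n, last v p \in Lambda
          & sigma (last v p) != tau (last v p)]) d ->
    `|graph_marginal v s Lambda sigma - graph_marginal v s Lambda tau|
      <= rate_at delta d.

End Graph.

(* ---------- The infinite (b+1)-regular tree ---------- *)

(* A node is the sequence of child indices read on the way down from the root
   [::], so that its depth is its size, its children are the [rcons w i], and
   the ancestor-or-self relation is [prefix]. *)
Definition nchild (b : nat) (w : seq nat) : nat :=
  if w is [::] then b.+1 else b.

Definition is_node (b : nat) (w : seq nat) : bool :=
  if w is i :: w' then (i < b.+1)%N && all (fun j => (j < b)%N) w' else true.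

(* [lines t l] : there is a coupling line with top endpoint t and lower
   endpoint l. *)
Definition valid_lines (b : nat) (lines : rel (seq nat)) : Prop :=
  [/\ forall t l, lines t l -> [/\ is_node b l, prefix t l & t != l],
      forall t t' l, lines t l -> lines t' l -> t = t'
    & forall t l t' l', lines t l -> lines t' l' -> (t, l) <> (t', l') ->
        ~ exists p, [&& prefix t p, prefix l p, prefix t' p & prefix l' p] ].

Section Tree.
Variables (R : realType) (S : finType) (b : nat).
Variables (Phi : S -> S -> R) (phi : S -> R) (sq : S).

(* Partial assignments of spins to nodes. *)
Definition assignment := seq nat -> option S.

Definition frozen_on (Lambda : pred (seq nat)) (sigma : seq nat -> S) :
    assignment :=
  fun w => if Lambda w then Some (sigma w) else None.

Definition freeze_lines (lines : rel (seq nat)) (eta : assignment)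
    (w : seq nat) (s : S) : assignment :=
  fun x => if eta x is Some a then Some a
           else if lines w x then Some s else None.

(* Division by the reference value; a zero reference value is dropped.  The
   recursion below divides by zero only if phi sq = 0 or if a child of w is
   frozen to some f with Phi sq f = 0 (for the spin sets with a permissive spin
   all other denominators are positive).  Unless that child is coupled to w
   itself, the divisor does not depend on the spin s of w, hence is a factor
   common to all R_w(s), which cancels in marginals.  The usual convention
   x / 0 = 0 would instead erase the whole vector R_w. *)
Definition refdiv (x y : R) : R := if y == 0 then x else x / y.

(* The recursion, cut at n levels below w; the value for n = 0 at an unfrozen
   node is never used when n bounds the height of the pruned tree. *)
Fixpoint ratio (lines : rel (seq nat)) (n : nat) (eta : assignment)
    (w : seq nat) (s : S) : R :=
  if eta w is Some a then (s == a)%:R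
  else if n is m.+1 then
    refdiv (phi s) (phi sq) *
    \prod_(i < nchild b w)
      refdiv
        (\sum_(l : S) Phi s l *
           ratio lines m (freeze_lines lines eta w s) (rcons w i) l)
        (\sum_(l : S) Phi sq l *
           ratio lines m (freeze_lines lines eta w s) (rcons w i) l)
  else 0.

Definition tree_marginal (lines : rel (seq nat)) (n : nat) (eta : assignment)
    (s : S) : R :=
  ratio lines n eta [::] s / \sum_(l : S) ratio lines n eta [::] l.

(* Nodes that remain after pruning strictly below the frozen nodes and strictly
   below the lower endpoints of coupling lines. *)
Definition kept (lines : rel (seq nat)) (Lambda : pred (seq nat))
    (w : seq nat) : Prop :=
  is_node b w /\
  forall u, prefix u w -> u != w -> ~~ Lambda u /\ (forall t, ~~ lines t u).

(* As the tree is locally finite, the pruned tree is finite if and only if it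
   has bounded height. *)
Definition pruned_height_le (lines : rel (seq nat)) (Lambda : pred (seq nat))
    (n : nat) : Prop :=
  forall w, kept lines Lambda w -> (size w <= n)%N.

Definition vssm (delta : nat -> R) : Prop :=
  forall (s : S) (lines : rel (seq nat)) (Lambda : pred (seq nat))
         (sigma tau : seq nat -> S) (n : nat) (d : option nat),
    valid_lines b lines ->
    (forall w, Lambda w -> is_node b w) ->
    pruned_height_le lines Lambda n ->
    is_dist (fun k => exists w : seq nat,
        [/\ Lambda w, sigma w != tau w & size w = k]) d ->
    `|tree_marginal lines n (frozen_on Lambda sigma) s -
      tree_marginal lines n (frozen_on Lambda tau) s| <= rate_at delta d.

End Tree.

(* ---------- The extra permissive spin: [None : option X] ---------- *)

Definition ext_Phi (R : realType) (X : finType) (Phi : X -> X -> R) (c2 : R)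
    (a a' : option X) : R :=
  if (a, a') is (Some s, Some t) then Phi s t else c2.

Definition ext_phi (R : realType) (X : finType) (phi : X -> R) (c3 : R)
    (a : option X) : R :=
  if a is Some s then phi s else c3.

(* Main.v *)
(* Unfold the graph from v into the tree of its walks, stopping where a walk
   closes a cycle. Let u be the vertex reached, removed from the graph together
   with its ancestors. Its spin s acts on the remaining neighbours y_1, ..., y_k;
   the partition functions H_m, where y_1, ..., y_m see s and the others see the
   reference spin, satisfy H_k = H_0 * prod_m (H_m / H_(m-1)), and each quotient
   is the factor of the child y_m in the tree recursion, once the copies of u
   below y_m reached through a smaller index are coupled to u and those reached
   through a larger index are frozen to the reference spin. The permissive spin
   keeps every H_m positive and neutralizes the children of the regular tree
   that correspond to no walk. Hence the tree marginal with the extra spin of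
   weight c3 is the marginal of the graph with this extra spin, and letting c3
   tend to 0 gives the marginal on the original spin set. A shortest walk from v
   to the set of disagreement visits no vertex twice, hence lifts to a node of
   the tree of the same depth, so the two distances agree even when it crosses
   frozen vertices: the rate need not be monotone. *)
Require Import Defs.
From HB Require Import structures.
From mathcomp Require Import all_boot all_order all_algebra.
From mathcomp Require Import all_classical all_reals all_analysis.
From mathcomp Require Import ring.

Set Implicit Arguments.
Unset Strict Implicit.
Unset Printing Implicit Defensive.

Import Order.TTheory GRing.Theory Num.Theory numFieldNormedType.Exports.

Local Open Scope ring_scope.

Section BoundaryWeights.
Variables (R : realType) (S V : finType) (e : rel V).
Variables (Phi : S -> S -> R) (phi : S -> R).
Hypothesis Phi_sym : forall s t, Phi s t = Phi t s.
Hypotheses (e_sym : symmetric e) (e_irr : irreflexive e).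

(* Weight of [x] on the subgraph induced by [U], where an edge [y -- z] leaving
   [U] is felt by [y] as a pendant vertex frozen to [c y z]; distinct neighbours
   [y] may thus see distinct spins at the same removed vertex [z]. *)
Definition cweight (U : {set V}) (c : V -> V -> S) (x : {ffun V -> S}) : R :=
  \prod_(y in U) (phi (x y) * \prod_(z | e y z)
     (if z \in U then
        if (enum_rank y < enum_rank z)%N then Phi (x y) (x z) else 1
      else Phi (x y) (c y z))).

Definition csum (U : {set V}) (rho : {ffun V -> S}) (c : V -> V -> S) : R :=
  \sum_(x | agree (~: U) rho x) cweight U c x.

Definition csum_at (U : {set V}) (rho : {ffun V -> S}) (c : V -> V -> S)
    (u : V) (s : S) : R :=
  \sum_(x | agree (~: U) rho x && (x u == s)) cweight U c x.

Definition recolor (x : {ffun V -> S}) (u : V) (s : S) : {ffun V -> S} :=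
  [ffun y => if y == u then s else x y].

Lemma cweight_remove (U : {set V}) c c' (x : {ffun V -> S}) u :
  u \in U ->
  (forall y z, y \in U :\ u -> e y z -> z \notin U -> c' y z = c y z) ->
  (forall y, y \in U :\ u -> e y u -> c' y u = x u) ->
  cweight U c x =
  phi (x u) * \prod_(z | e u z && (z \notin U)) Phi (x u) (c u z) *
    cweight (U :\ u) c' x.
Proof.
move=> uU c'_old c'_new.
pose F y z := if (enum_rank y < enum_rank z)%N then Phi (x y) (x z) else 1.
pose G y z := if z \in U then F y z else Phi (x y) (c y z).
pose G' y z := if z \in U :\ u then F y z else Phi (x y) (c' y z).
have rowE y : y \in U :\ u ->
    \prod_(z | e y z) G' y z = \prod_(z | e y z) G y z * (if e y u then F u y else 1).
  move=> yU; have yu : y != u by move: yU; rewrite !inE => /andP[].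
  have [eyu|neyu] := boolP (e y u); last first.
    rewrite mulr1; apply: eq_bigr => z eyz.
    have zu : z != u by apply: contraNneq neyu => <-.
    rewrite /G' /G !inE zu /=; case: ifPn => // zU.
    by rewrite c'_old.
  rewrite (bigD1 u) //= [in RHS](bigD1 u) //= mulrAC; congr (_ * _).
    rewrite /G' /G !inE eqxx uU /= c'_new // /F.
    have : enum_rank y != enum_rank u by rewrite (inj_eq enum_rank_inj).
    rewrite -(inj_eq val_inj) neq_ltn; case/orP => lt.
      by rewrite lt ltnNge (ltnW lt) mulr1.
    by rewrite lt ltnNge (ltnW lt) mul1r Phi_sym.
  apply: eq_bigr => z /andP[eyz zu].
  rewrite /G' /G !inE zu /=; case: ifPn => // zU.
  by rewrite c'_old.
rewrite /cweight (big_setD1 u uU) /=.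
under [X in _ = _ * X]eq_bigr => y yU do rewrite rowE // mulrA.
rewrite [in RHS]big_split /= -!mulrA; congr (_ * _).
rewrite (bigID (mem U)) /= [X in X * _ = _]mulrC -mulrA.
congr (_ * _); first by apply: eq_bigr => z /andP[_ /negbTE zU]; rewrite zU.
rewrite mulrC; congr (_ * _).
rewrite -big_mkcondr /=.
apply: eq_big => [z|z /andP[euz zU]]; last by rewrite zU.
rewrite !inE e_sym; case: (eqVneq z u) => [->|]; last by rewrite andbC.
by rewrite e_irr.
Qed.

Lemma cweight_eq (U : {set V}) c c' (x x' : {ffun V -> S}) :
  {in U, x =1 x'} ->
  (forall y z, y \in U -> e y z -> z \notin U -> c y z = c' y z) ->
  cweight U c x = cweight U c' x'.
Proof.
move=> xx' cc'; apply: eq_bigr => y yU; rewrite xx' //; congr (_ * _).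
apply: eq_bigr => z eyz; case: ifPn => zU; first by rewrite xx'.
by rewrite cc'.
Qed.

Lemma cweight_swap (U : {set V}) c c' (x : {ffun V -> S}) y u :
  y \in U -> u \notin U -> e y u ->
  (forall y' z, (y', z) != (y, u) -> c y' z = c' y' z) ->
  cweight U c x * Phi (x y) (c' y u) = cweight U c' x * Phi (x y) (c y u).
Proof.
move=> yU uU eyu cc'; rewrite /cweight.
rewrite (big_setD1 y yU) /= (bigD1 u eyu) /= (negbTE uU).
rewrite [in RHS](big_setD1 y yU) /= [in RHS](bigD1 u eyu) /= (negbTE uU).
set A := \prod_(i in _) _; set A' := \prod_(i in _) _.
set B := \prod_(i | _) _; set B' := \prod_(i | _) _.
have -> : A = A'.
  apply: eq_bigr => z; rewrite !inE => /andP[zy zU]; congr (_ * _).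
  by apply: eq_bigr => w _; case: ifP => // _; rewrite cc' // xpair_eqE (negbTE zy).
have -> : B = B'.
  apply: eq_bigr => w /andP[_ wu]; case: ifP => // _.
  by rewrite cc' // xpair_eqE (negbTE wu) andbF.
ring.
Qed.

Lemma recolor_id x u : recolor x u (x u) = x.
Proof. by apply/ffunP => y; rewrite ffunE; case: eqP => [->|]. Qed.

Lemma recolorK x u s t : recolor (recolor x u s) u t = recolor x u t.
Proof. by apply/ffunP => y; rewrite !ffunE; case: eqP. Qed.

Lemma csum_at_remove (U : {set V}) rho c u s :
  u \in U ->
  csum_at U rho c u s =
  phi s * \prod_(z | e u z && (z \notin U)) Phi s (c u z) *
    csum (U :\ u) rho (fun y z => if z == u then s else c y z).
Proof.
move=> uU; rewrite /csum_at /csum mulr_sumr.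
rewrite (reindex_onto (fun x => recolor x u s) (fun x => recolor x u (rho u))) /=;
  last first.
  by move=> x /andP[_ /eqP <-]; rewrite recolorK recolor_id.
apply: eq_big => [x|x /andP[/andP[_ /eqP xus] _]]; last first.
  rewrite (cweight_remove (c' := fun y z => if z == u then s else c y z) uU).
  - rewrite xus; congr (_ * _); apply: cweight_eq => // y.
    by rewrite !inE => /andP[/negbTE yu _]; rewrite ffunE yu.
  - move=> y z _ _ zU; case: eqP => // zu; by rewrite zu uU in zU.
  - by move=> y _ _; rewrite eqxx xus.
rewrite [recolor x u s u]ffunE !eqxx andbT recolorK.
apply/andP/forall_inP => [[/forall_inP xrho /eqP xu] i|xrho].
  rewrite !inE negb_and negbK => /orP[/eqP ->|iU].
    by rewrite -xu ffunE eqxx.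
  have := xrho i; rewrite inE ffunE; case: (eqVneq i u) iU => [->|_] iU; last exact.
  by rewrite uU in iU.
split.
  apply/forall_inP => i iU; rewrite ffunE; case: (eqVneq i u) => [iu|iu].
    by move: iU; rewrite iu inE uU.
  by apply: xrho; move: iU; rewrite !inE (negbTE iu).
apply/eqP/ffunP => i; rewrite ffunE; case: eqP => // ->.
by apply/esym/eqP/xrho; rewrite !inE eqxx.
Qed.

Lemma csum_split (U : {set V}) rho c u :
  csum U rho c = \sum_s csum_at U rho c u s.
Proof.
rewrite /csum (partition_big (fun x : {ffun V -> S} => x u) predT) //=.
Qed.

Lemma csum_eq (U : {set V}) rho c c' :
  (forall y z, y \in U -> e y z -> z \notin U -> c y z = c' y z) ->
  csum U rho c = csum U rho c'.
Proof. by move=> cc'; apply: eq_bigr => x _; apply: cweight_eq. Qed.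

(* Replacing the spin seen through the edge [y -- u] by [o], which acts as the
   constant [c2], amounts to deleting that edge. *)
Lemma csum_cut (U : {set V}) rho c c' y u o c2 :
  (forall s, Phi s o = c2) ->
  y \in U -> u \notin U -> e y u -> c' y u = o ->
  (forall y' z, (y', z) != (y, u) -> c y' z = c' y' z) ->
  csum U rho c * c2 = \sum_l Phi (c y u) l * csum_at U rho c' y l.
Proof.
move=> Phio yU uU eyu c'o cc'; rewrite (csum_split _ _ _ y) mulr_suml.
apply: eq_bigr => l _; rewrite mulr_suml mulr_sumr.
apply: eq_bigr => x /andP[_ /eqP xy].
by rewrite -(Phio (x y)) -c'o (cweight_swap _ yU uU eyu) // mulrC xy Phi_sym.
Qed.

Section Positivity.
Hypotheses (Phi_ge0 : forall s t, 0 <= Phi s t) (phi_ge0 : forall s, 0 <= phi s).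

Lemma cweight_ge0 U c x : 0 <= cweight U c x.
Proof.
apply: prodr_ge0 => y _; apply: mulr_ge0 => //; apply: prodr_ge0 => z _.
by do 2?case: ifP.
Qed.

Lemma csum_gt0 (U : {set V}) rho c o c2 :
  (forall s, Phi s o = c2) -> 0 < c2 -> 0 < phi o -> 0 < csum U rho c.
Proof.
move=> Phio c2_gt0 phio; rewrite /csum.
pose x := [ffun y => if y \in U then o else rho y].
rewrite (bigD1 x) /=; last first.
  by apply/forall_inP => y; rewrite inE ffunE => /negbTE ->.
apply: ltr_wpDr; first by apply: sumr_ge0 => *; apply: cweight_ge0.
apply: prodr_gt0 => y yU; rewrite ffunE yU; apply: mulr_gt0 => //.
apply: prodr_gt0 => z _; case: ifP => zU; last by rewrite Phi_sym Phio.
by rewrite ffunE zU Phio; case: ifP.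
Qed.

End Positivity.
End BoundaryWeights.

Lemma is_node_rcons b w i :
  is_node b (rcons w i) = is_node b w && (i < nchild b w)%N.
Proof. by case: w => [|j w] //=; rewrite ?andbT // all_rcons andbA andbAC. Qed.

Lemma prefix_common (T : eqType) (s t p : seq T) :
  prefix s p -> prefix t p -> (size s <= size t)%N -> prefix s t.
Proof.
move=> /prefixP[q ->] /prefixP[q' qq'] le_st.
by rewrite prefixE -(takel_cat q' le_st) -qq' take_size_cat.
Qed.

Section WalkTree.
Variables (V : finType) (e : rel V) (b : nat) (v : V) (Lambda : {set V}).
Hypotheses (e_sym : symmetric e) (e_irr : irreflexive e).
Hypothesis e_deg : (maxdeg e <= b.+1)%N.

(* A node of the regular tree spells a non-backtracking walk from [v], kept in
   reverse order so that its head is the current vertex; [::] marks the nodes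
   that spell no walk or lie strictly below the closing of a cycle. *)
Definition kids (r : seq V) : seq V :=
  if r is u :: r' then [seq y <- enum V | e u y && (ohead r' != Some y)]
  else [::].

Definition walk_step (r : seq V) (i : nat) : seq V :=
  if uniq r && (i < size (kids r))%N then nth v (kids r) i :: r else [::].

Definition walk (w : seq nat) : seq V := foldl walk_step [:: v] w.

(* When the walk closes a cycle at [z], the earlier occurrence of [z] is coupled
   to its copies reached through smaller child indices than the one along which
   the cycle left [z]; the other copies are frozen to the reference spin. *)
Definition wlines (t l : seq nat) : bool :=
  [&& is_node b l, prefix t l, t != l &
    if walk l is z :: r then
      [&& z \notin Lambda, ohead (walk t) == Some z &
          (index (head z r) (kids (walk t)) < nth 0 l (size t))%N]
    else false].

Definition wfrozen (l : seq nat) : bool :=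
  is_node b l &&
  if walk l is z :: r then
    (z \in Lambda) ||
    (z \in r) && ~~ has (fun k => wlines (take k l) l) (iota 0 (size l))
  else true.

Lemma walk_rcons w i : walk (rcons w i) = walk_step (walk w) i.
Proof. exact: foldl_rcons. Qed.

Lemma walk_rconsE w i z r :
  walk (rcons w i) = z :: r ->
  [/\ walk w = r, uniq r, (i < size (kids r))%N & z = nth v (kids r) i].
Proof. by rewrite walk_rcons /walk_step; case: ifP => // /andP[? ?] [<- <-]. Qed.

Lemma mem_kids z u r :
  (z \in kids (u :: r)) = e u z && (ohead r != Some z).
Proof. by rewrite mem_filter mem_enum andbT. Qed.

Lemma walk_strict w i q z r :
  walk (w ++ i :: q) = z :: r ->
  [/\ walk w != [::], suffix (walk w) r & uniq r].
Proof.
elim/last_ind: q z r => [|q j IHq] z r.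
  rewrite cats1 => /walk_rconsE[<- ? ik _]; rewrite suffix_refl; split => //.
  by case: (walk w) ik.
rewrite -rcons_cons -rcons_cat => /walk_rconsE[wq ur ij _].
case: r wq ur ij => [|y r] // wq ur _.
have [ne0 sr _] := IHq _ _ wq; split => //.
exact: suffix_trans sr (suffix_cons _ _).
Qed.

Lemma size_walk w : walk w != [::] -> size (walk w) = (size w).+1.
Proof.
elim/last_ind: w => [|w i IHw] // ne0.
case Ew : (walk (rcons w i)) ne0 => [|z r] // _.
have [wr _ ik _] := walk_rconsE Ew.
by rewrite /= size_rcons -IHw wr //; case: (r) ik.
Qed.

Lemma walk_size_le w : uniq (walk w) -> walk w != [::] -> (size w < #|V|)%N.
Proof.
by move=> uw ne0; rewrite -size_walk // -(card_uniqP uw) max_card.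
Qed.

Lemma kids_uniq r : uniq (kids r).
Proof. by case: r => [|u r] //; apply: filter_uniq; apply: enum_uniq. Qed.

Lemma size_kids w : (size (kids (walk w)) <= nchild b w)%N.
Proof.
have deg u : (#|[set y | e u y]| <= b.+1)%N.
  exact: leq_trans (leq_bigmax u) e_deg.
case: (lastP w) => [|w' i].
  apply: leq_trans (deg v); rewrite cardE; apply: uniq_leq_size => [|y].
    exact: (kids_uniq [:: v]).
  by rewrite mem_kids mem_enum inE andbT.
case Ew : (walk (rcons w' i)) => [|u r] //.
have [wr ur ik zi] := walk_rconsE Ew.
case: r ur ik zi wr {Ew} => [|p r] // _ ik zi _.
have eup : e u p.
  by have := mem_nth v ik; rewrite -zi mem_kids e_sym => /andP[].
have -> : nchild b (rcons w' i) = b by case: w'.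
rewrite -ltnS; apply: leq_trans (deg u).
rewrite (cardsD1 p) inE eup ltnS.
rewrite cardE; apply: uniq_leq_size (kids_uniq _) _ => y.
by rewrite mem_kids mem_enum !inE /= => /andP[-> py]; rewrite andbT; apply: contraNneq py => ->.
Qed.

Lemma top_unique t t' l :
  prefix t l -> prefix t' l -> t != l -> t' != l -> walk l != [::] ->
  ohead (walk t) = ohead (walk t') -> t = t'.
Proof.
wlog le_tt' : t t' / (size t <= size t')%N.
  move=> H; have [/H//|/ltnW/H {}H] := leqP (size t) (size t').
  by move=> ? ? ? ? ? ?; apply/esym/H.
move=> tl t'l ntl nt'l ne0 ohd.
have /prefixP[q0 t'E] := prefix_common tl t'l le_tt'.
have /prefixP[q' qq'] := t'l.
case: q0 t'E => [|i q0] t'E; first by rewrite t'E cats0.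
case: q' qq' => [|j q'] qq'; first by rewrite qq' cats0 eqxx in nt'l.
move: ne0; rewrite qq'.
case El : (walk (t' ++ _)) => [|z r] // _.
have [ne0 sr ur] := walk_strict El.
have := suffix_uniq sr ur.
case Et' : (walk t') ohd ne0 => [|y r'] //= ohd _.
move: (Et'); rewrite t'E => /walk_strict[_ /suffixP[s' ->] _].
case: (walk t) ohd => // a s [->].
by rewrite mem_cat inE eqxx orbT.
Qed.

Lemma wlines_top_uniq t t' l : wlines t l -> wlines t' l -> t = t'.
Proof.
move=> /and4P[_ tl ntl +] /and4P[_ t'l nt'l].
case El : (walk l) => [|z r] // /and3P[_ /eqP tz _] /and3P[_ /eqP t'z _].
by apply: top_unique ntl nt'l _ _; rewrite ?El ?tz ?t'z.
Qed.

Lemma wlines_closing t l z r : wlines t l -> walk l = z :: r -> z \in r.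
Proof.
move=> /and4P[_ /prefixP[q ->] ntl +] El; rewrite El => /and3P[_ /eqP tz _].
case: q ntl El => [|i q]; first by rewrite cats0 eqxx.
move=> _ /walk_strict[_ /suffixP[s ->] _].
case: (walk t) tz => // a r' [->]; by rewrite mem_cat inE eqxx orbT.
Qed.

Lemma wlines_prefix_eq t l t' l' :
  wlines t l -> wlines t' l' -> prefix l l' -> l = l'.
Proof.
move=> tl tl' /prefixP[[|i q] l'E]; first by rewrite l'E cats0.
have /and4P[_ _ _] := tl'; have /and4P[_ _ _] := tl.
case El : (walk l) => [|z r] // _.
case El' : (walk l') => [|z' r'] // _.
have [_ sr ur] := walk_strict (etrans (esym (congr1 walk l'E)) El').
by have := suffix_uniq sr ur; rewrite El /= (wlines_closing tl El).
Qed.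

Lemma valid_wlines : valid_lines b wlines.
Proof.
split.
- by move=> t l /and4P[].
- exact: wlines_top_uniq.
move=> t l t' l' tl tl' ne [p /and4P[_ lp _ l'p]]; apply: ne.
have ll' : l = l'.
  case: (leqP (size l) (size l')) => [le|/ltnW le].
    exact: wlines_prefix_eq tl tl' (prefix_common lp l'p le).
  exact/esym/(wlines_prefix_eq tl' tl)/(prefix_common l'p lp le).
by rewrite ll' in tl *; rewrite (wlines_top_uniq tl tl').
Qed.

Lemma wfrozenPn w z r : is_node b w -> walk w = z :: r -> ~~ wfrozen w ->
  z \notin Lambda /\ (z \in r -> exists t, wlines t w).
Proof.
rewrite /wfrozen => -> -> /=; rewrite negb_or => /andP[zL]; split => // zr.
by move: b0; rewrite zr /= negbK => /hasP[k _ ?]; exists (take k w).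
Qed.

Lemma wpruned_height : pruned_height_le b wlines wfrozen #|V|.
Proof.
move=> w [nw kw]; case: (lastP w) nw kw => [|w' i] //; rewrite is_node_rcons.
move=> /andP[nw' _] /(_ w' (prefix_rcons _ _)) [].
  by apply/eqP => /(congr1 size)/eqP; rewrite size_rcons eqn_leq ltnn andbF.
move=> nf nl; rewrite size_rcons.
case Ew' : (walk w') => [|z r]; first by rewrite /wfrozen nw' Ew' in nf.
have [_ zr] := wfrozenPn nw' Ew' nf.
apply: walk_size_le; rewrite Ew' //= andbC.
have -> /= : uniq r.
  case: (lastP w') Ew' => [[_ <-] //|w1 j /walk_rconsE[]//].
by apply/negP => /zr[t]; rewrite (negbTE (nl t)).
Qed.

Lemma walk_path w z r : walk w = z :: r ->
  exists p, [/\ path e v p, size p = size w & last v p = z].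
Proof.
elim/last_ind: w z r => [|w i IHw] z r; first by case=> <- _; exists [::].
move=> /walk_rconsE[wr _ ik zE]; case: r wr ik zE => // u r' wr ik zE.
have [p [pp sp lp]] := IHw _ _ wr; exists (rcons p z).
rewrite rcons_path pp last_rcons !size_rcons sp lp; split => //.
by have := mem_nth v ik; rewrite -zE mem_kids => /andP[].
Qed.

Lemma walk_lift p : path e v p -> uniq (v :: p) ->
  exists w, [/\ is_node b w, size w = size p & walk w = rev (v :: p)].
Proof.
elim/last_ind: p => [|p y IHp]; first by exists [::].
rewrite rcons_path -rcons_cons rcons_uniq => /andP[pp ey] /andP[yp up].
have [w [nw sw wp]] := IHp pp up.
have wE : walk w = last v p :: rev (belast v p) by rewrite wp lastI rev_rcons.
have yk : y \in kids (walk w).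
  rewrite wE mem_kids ey; case Er : (rev _) => [|a r] //=.
  apply: contraNneq yp => -[<-]; rewrite lastI mem_rcons inE.
  by rewrite -mem_rev Er mem_head orbT.
exists (rcons w (index y (kids (walk w)))).
rewrite is_node_rcons nw !size_rcons sw rev_rcons -wp walk_rcons; split => //=.
  by apply: leq_trans (size_kids w); rewrite index_mem.
by rewrite /walk_step index_mem yk nth_index // wp rev_uniq up.
Qed.

Section Spins.
Variables (S : eqType) (o sq : S).

Definition wspin (rho : V -> S) (w : seq nat) : S :=
  if walk w is z :: _ then if z \in Lambda then rho z else sq else o.

Lemma wspin_dist (sigma tau : V -> S) d :
  is_dist (fun n => exists p, [/\ path e v p, size p = n, last v p \in Lambda
                                & sigma (last v p) != tau (last v p)]) d ->
  is_dist (fun n => exists w, [/\ wfrozen w, wspin sigma w != wspin tau w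
                                & size w = n]) d.
Proof.
set G := (X in is_dist X d -> _); set T := (X in _ -> is_dist X d).
have TG n : T n -> G n.
  case=> w [_ + sw]; rewrite /wspin; case Ew : (walk w) => [|z r]; first by rewrite eqxx.
  case: ifP => [zL ne|]; last by rewrite eqxx.
  by have [p [pp sp lp]] := walk_path Ew; exists p; rewrite lp sp.
have GT n : G n -> (forall m, (m < n)%N -> ~ G m) -> T n.
  move=> [p [pp sp lL ne]] minn; move: sp lL ne.
  case: (shortenP pp) => p' pp' up' sub sp lL ne.
  have p'n : size p' = n.
    have up0 : uniq p' by case/andP: up'.
    have := uniq_leq_size up0 sub; rewrite sp leq_eqVlt => /orP[/eqP //|lt].
    by case: (minn _ lt); exists p'.
  have [w [nw sw wE]] := walk_lift pp' up'; exists w.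
  by rewrite /wfrozen /wspin wE lastI rev_rcons lL nw sw p'n.
case: d => [n [Gn minn]|noG n /TG /noG //].
by split; [exact: GT | move=> m /minn nG /TG].
Qed.

End Spins.

Lemma walk_no_backtrack w y z r i q u r' :
  walk w = y :: z :: r -> walk (w ++ i :: q) = u :: r' -> u = z ->
  head u r' != y.
Proof.
move=> wE + uz; rewrite uz; elim/last_ind: q => [|q j _].
  rewrite cats1 => /walk_rconsE[wr' _ ik zE].
  have := mem_nth v ik; rewrite -zE -wr' wE mem_kids /=.
  by rewrite eqxx andbF.
rewrite -rcons_cons -rcons_cat => /walk_rconsE[wr' ur' ik zE].
case: r' wr' ur' ik zE => [|a r'] // wr' /andP[ar' _] _ _.
have [_ /suffixP[s rE] _] := walk_strict wr'.
apply: contraNneq ar' => /= ->.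
by rewrite rE mem_cat wE mem_head orbT.
Qed.

Section Recursion.
Variables (R : realType) (S : finType) (Phi : S -> S -> R) (phi : S -> R).
Variables (o sq : S) (c2 : R) (rho : {ffun V -> S}).
Hypotheses (Phi_sym : forall s t, Phi s t = Phi t s).
Hypotheses (Phi_ge0 : forall s t, 0 <= Phi s t) (phi_ge0 : forall s, 0 <= phi s).
Hypotheses (Phi_o : forall s, Phi s o = c2) (c2_gt0 : 0 < c2) (phi_o : 0 < phi o).

Definition unvisited (r : seq V) : {set V} :=
  [set z | (z \notin Lambda) && (z \notin r)].

Lemma unvisited_cons u r : unvisited (u :: r) = unvisited r :\ u.
Proof. by apply/setP => z; rewrite !inE negb_or andbCA. Qed.

Lemma mem_kids_unvisited y u r :
  y \in unvisited r -> e y u -> y \in kids (u :: r).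
Proof.
rewrite mem_kids e_sym => yU -> /=; case: r yU => [|p r] //=.
by rewrite !inE negb_or => /andP[_ /andP[yp _]]; apply: contraNneq yp => -[->].
Qed.

(* Below [w], whose strict ancestors together with [Lambda] are the complement
   of [U], the assignment [eta] realizes the boundary spins [c]. *)
Definition coherent (w : seq nat) (U : {set V}) (c : V -> V -> S)
    (eta : assignment S) : Prop :=
  forall i q, is_node b (w ++ i :: q) ->
  eta (w ++ i :: q) =
    if walk (w ++ i :: q) is z :: r then
      if z \in U then if wfrozen (w ++ i :: q) then Some sq else None
      else Some (c (head z r) z)
    else Some o.

(* Boundary spins seen from the [i]-th child of [u]: the spin [o] cancels the
   edge between that child and [u]. *)
Definition branch_spins (c : V -> V -> S) (u : V) (N : seq V) (s : S) (i : nat)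
    (y z : V) : S :=
  if z == u then
    if index y N == i then o else if (index y N < i)%N then s else sq
  else c y z.

Lemma coherent_branch w u r c eta i s :
  walk w = u :: r -> u \in unvisited r -> (i < size (kids (u :: r)))%N ->
  walk (rcons w i) = nth v (kids (u :: r)) i :: u :: r ->
  coherent w (unvisited r) c eta ->
  coherent (rcons w i) (unvisited (u :: r))
    (branch_spins c u (kids (u :: r)) s i) (freeze_lines wlines eta w s).
Proof.
move=> wE uU iN wiE coh j q; rewrite cat_rcons => nx.
have hx := coh i (j :: q) nx; rewrite /freeze_lines {}hx.
set x := w ++ i :: j :: q in nx *.
case Ex : (walk x) => [|z r'] //.
rewrite unvisited_cons in_setD1.
have [zu|zu] := eqVneq z u; last first.
  rewrite /branch_spins (negbTE zu) /=; case: ifP => // _.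
  case: ifP => // _; suff -> : wlines w x = false by [].
  by rewrite /wlines Ex wE /= (inj_eq Some_inj) [u == z]eq_sym (negbTE zu) !andbF.
subst z; rewrite uU /branch_spins eqxx /=.
have nidx : index (head u r') (kids (u :: r)) != i.
  have Ex' : walk (rcons w i ++ j :: q) = u :: r' by rewrite cat_rcons.
  apply: contraNneq (walk_no_backtrack wiE Ex' erefl) => idx.
  by rewrite -idx nth_index // -index_mem idx.
rewrite (negbTE nidx).
have uL : u \notin Lambda by move: uU; rewrite inE => /andP[].
have px : prefix w x by apply: prefix_prefix.
have wx : w != x.
  by apply/eqP => /(congr1 size)/eqP; rewrite size_cat /= addnS eqn_leq ltnNge leq_addr andbF.
have wl : wlines w x = (index (head u r') (kids (u :: r)) < i)%N.
  by rewrite /wlines nx px wx Ex uL wE /= eqxx /x nth_cat ltnn subnn.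
rewrite -wl; case: ifPn => [fx|nfx].
  case: ifPn => // lx; move: fx; rewrite /wfrozen nx Ex (negbTE uL) /=.
  case/andP => _ /hasP[]; exists (size w).
    by rewrite mem_iota /= /x size_cat /= addnS ltnS leq_addr.
  by rewrite /x take_size_cat.
have [_ cl] := wfrozenPn nx Ex nfx.
have ur' : u \in r'.
  have [_ /suffixP[s' ->] _] := walk_strict Ex.
  by rewrite mem_cat wE mem_head orbT.
have [t tx] := cl ur'; suff <- : t = w by rewrite tx.
have /and4P[_ pt ntx] := tx; rewrite Ex => /and3P[_ /eqP tu _].
by apply: top_unique pt px ntx wx _ _; rewrite ?Ex // tu wE.
Qed.

Lemma ratio_frozen lines n (eta : assignment S) w a s :
  eta w = Some a -> Defs.ratio b Phi phi sq lines n eta w s = (s == a)%:R.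
Proof. by case: n => [|n] /= ->. Qed.

Lemma sum_indic (f : S -> R) a : \sum_l f l * (l == a)%:R = f a.
Proof.
rewrite (bigD1 a) //= eqxx mulr1 big1 ?addr0 // => l /negbTE ->.
by rewrite mulr0.
Qed.

Lemma refdivE (x y : R) : refdiv x y = x * (if y == 0 then 1 else y^-1).
Proof. by rewrite /refdiv; case: ifP; rewrite ?mulr1. Qed.

Lemma refdiv_factor_gt0 (y : R) : 0 <= y -> 0 < (if y == 0 then 1 else y^-1).
Proof. by case: eqP => // /eqP y0 yge; rewrite invr_gt0 lt_def y0. Qed.

Section Step.
Variables (n : nat) (w : seq nat) (u : V) (r : seq V) (c : V -> V -> S)
  (eta : assignment S).
Hypotheses (wE : walk w = u :: r) (u_r : uniq (u :: r)) (nw : is_node b w)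
  (uL : u \notin Lambda) (coh : coherent w (unvisited r) c eta).

Let N := kids (u :: r).
Let U := unvisited (u :: r).

(* The first [m] neighbours see the removed vertex [u] with spin [s], the others
   with the reference spin: consecutive hybrids differ at one neighbour. *)
Definition hybrid (s : S) (m : nat) (y z : V) : S :=
  if z == u then if (index y N < m)%N then s else sq else c y z.

Definition hsum (s : S) (m : nat) : R := csum e Phi phi U rho (hybrid s m).

Lemma hsum_gt0 s m : 0 < hsum s m.
Proof. exact: csum_gt0 Phi_o c2_gt0 phi_o. Qed.

Lemma hsum0 s : hsum s 0 = hsum sq 0.
Proof. by apply: csum_eq => y z _ _ _; rewrite /hybrid !ltn0. Qed.

Lemma hsum_skip s i :
  (i < size N)%N && (nth v N i \in unvisited r) = false -> hsum s i.+1 = hsum s i.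
Proof.
move=> skip; apply: csum_eq => y z yU eyz _; rewrite /hybrid; case: eqP => // zu.
rewrite ltnS leq_eqVlt; case: eqP => //= iE; move: yU skip.
rewrite /U unvisited_cons in_setD1 => /andP[_ yU].
have yN : y \in N by rewrite mem_kids_unvisited // -zu.
by rewrite -iE index_mem yN nth_index // yU.
Qed.

Lemma hsum_last s m : (size N <= m)%N ->
  hsum s m = csum e Phi phi (unvisited r :\ u) rho
               (fun y z => if z == u then s else c y z).
Proof.
move=> Nm; rewrite /hsum /U unvisited_cons.
apply: csum_eq => y z; rewrite in_setD1 => /andP[_ yU] eyz _.
rewrite /hybrid; case: eqP => // zu.
have -> // : (index y N < m)%N.
by apply: leq_trans Nm; rewrite index_mem mem_kids_unvisited // -zu.
Qed.

Definition closed_factor (s : S) (i : nat) : R :=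
  if (i < size N)%N && (nth v N i \notin unvisited r)
  then Phi s (c u (nth v N i)) else 1.

Hypothesis IH : forall i s, (i < size N)%N -> nth v N i \in unvisited r ->
  exists2 K, 0 < K & forall l,
    Defs.ratio b Phi phi sq wlines n (freeze_lines wlines eta w s) (rcons w i) l =
    K * csum_at e Phi phi U rho (branch_spins c u N s i) (nth v N i) l.

Lemma child_factor i : (i < nchild b w)%N -> exists2 k, 0 < k & forall s,
  refdiv
    (\sum_l Phi s l * Defs.ratio b Phi phi sq wlines n
       (freeze_lines wlines eta w s) (rcons w i) l)
    (\sum_l Phi sq l * Defs.ratio b Phi phi sq wlines n
       (freeze_lines wlines eta w s) (rcons w i) l) =
  k * closed_factor s i * (hsum s i.+1 / hsum s i).
Proof.
move=> ib.
have nx : is_node b (w ++ [:: i]) by rewrite cats1 is_node_rcons nw.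
have hx := coh nx; rewrite cats1 in hx.
have frz s a : eta (rcons w i) = Some a ->
    freeze_lines wlines eta w s (rcons w i) = Some a.
  by rewrite /freeze_lines => ->.
have hne s m : hsum s m != 0 by rewrite gt_eqF ?hsum_gt0.
have [iN|Ni] := ltnP i (size N); last first.
  have wi0 : walk (rcons w i) = [::].
    by rewrite walk_rcons wE /walk_step -/N ltnNge Ni andbF.
  rewrite wi0 in hx; exists 1 => // s.
  rewrite /closed_factor hsum_skip ltnNge Ni //= divff // !mulr1.
  under eq_bigr do rewrite (ratio_frozen _ _ _ (frz s _ hx)).
  under [X in refdiv _ X]eq_bigr do rewrite (ratio_frozen _ _ _ (frz s _ hx)).
  by rewrite !sum_indic !Phi_o /refdiv gt_eqF // divff // gt_eqF.
have wi : walk (rcons w i) = nth v N i :: u :: r.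
  by rewrite walk_rcons wE /walk_step u_r -/N iN.
rewrite wi in hx; have [yU|yU] := boolP (nth v N i \in unvisited r); last first.
  rewrite (negbTE yU) /= in hx.
  exists (if Phi sq (c u (nth v N i)) == 0 then 1 else (Phi sq (c u (nth v N i)))^-1).
    exact: refdiv_factor_gt0.
  move=> s; rewrite /closed_factor hsum_skip ?(negbTE yU) ?andbF // iN /=.
  rewrite divff // mulr1.
  under eq_bigr do rewrite (ratio_frozen _ _ _ (frz s _ hx)).
  under [X in refdiv _ X]eq_bigr do rewrite (ratio_frozen _ _ _ (frz s _ hx)).
  by rewrite !sum_indic refdivE mulrC.
exists 1 => // s; rewrite /closed_factor iN yU /= !mul1r.
have [K K0 KE] := IH s iN yU.
have uU : u \notin U by rewrite /U unvisited_cons in_setD1 eqxx.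
have eyu : e (nth v N i) u.
  by have := mem_nth v iN; rewrite mem_kids e_sym => /andP[].
have yu : nth v N i != u by apply: contraTneq eyu => ->; rewrite e_irr.
have yU' : nth v N i \in U by rewrite /U unvisited_cons in_setD1 yu.
have idx : index (nth v N i) N = i by rewrite index_uniq // kids_uniq.
have bo : branch_spins c u N s i (nth v N i) u = o.
  by rewrite /branch_spins eqxx idx eqxx.
have sumE t m : (t = s /\ m = i.+1) \/ (t = sq /\ m = i) ->
    \sum_l Phi t l * Defs.ratio b Phi phi sq wlines n
       (freeze_lines wlines eta w s) (rcons w i) l = K * (hsum s m * c2).
  move=> tm; rewrite /hsum (csum_cut phi Phi_sym rho Phi_o yU' uU eyu bo).
    rewrite mulr_sumr; apply: eq_bigr => l _; rewrite KE /hybrid eqxx idx.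
    by case: tm => -[-> ->]; rewrite ?ltnSn ?ltnn mulrCA.
  move=> y z; rewrite xpair_eqE /hybrid /branch_spins.
  case: (eqVneq z u) => //= _; rewrite andbT => yi.
  have iidx : (index y N == i) = false.
    by apply/negbTE; apply: contraNneq yi => yi; rewrite -yi nth_index // -index_mem yi.
  by rewrite iidx; case: tm => -[_ ->] //; rewrite ltnS leq_eqVlt iidx.
rewrite (sumE s i.+1) ?(sumE sq i); [|by right|by left].
rewrite /refdiv mulf_eq0 mulf_eq0 (gt_eqF K0) (gt_eqF (hsum_gt0 _ _)) (gt_eqF c2_gt0) /=.
have K1 := gt_eqF K0; have c1 := gt_eqF c2_gt0.
by field; rewrite K1 c1 hne.
Qed.

Lemma prod_closed_factor s m : (size N <= m)%N ->
  \prod_(i < m) closed_factor s i =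
  \prod_(z | e u z && (z \notin unvisited r) && (ohead r != Some z)) Phi s (c u z).
Proof.
move=> Nm; transitivity (\prod_(z <- N | z \notin unvisited r) Phi s (c u z)).
  rewrite (big_nth v) big_mkord (big_ord_widen_cond _ (fun i => nth v N i \notin unvisited r)
    (fun i => Phi s (c u (nth v N i))) Nm) [RHS]big_mkcond.
  by apply: eq_bigr => i _; rewrite /closed_factor andbC.
rewrite big_filter_cond big_enum_cond; apply: eq_bigl => z /=.
by rewrite andbAC.
Qed.

Lemma ratio_step :
  eta w = None -> (forall z, ohead r = Some z -> c u z = o) ->
  exists2 K, 0 < K & forall s,
    Defs.ratio b Phi phi sq wlines n.+1 eta w s =
    K * csum_at e Phi phi (unvisited r) rho c u s.
Proof.
move=> ew cpar.
have uU : u \in unvisited r by rewrite inE uL; case/andP: u_r.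
have Nw : (size N <= nchild b w)%N by rewrite /N -wE size_kids.
have /fin_all_exists2[k k_gt0 kE] (i : 'I_(nchild b w)) := child_factor (ltn_ord i).
set q : R := \prod_(z | e u z && (z \notin unvisited r) && ~~ (ohead r != Some z)) c2.
have q_gt0 : 0 < q by apply: prodr_gt0.
set k0 := if phi sq == 0 then 1 else (phi sq)^-1.
have k0_gt0 : 0 < k0 by apply: refdiv_factor_gt0.
have kk_gt0 : 0 < \prod_i k i by apply: prodr_gt0 => i _.
exists (k0 * \prod_i k i / (q * hsum sq 0)).
  by rewrite divr_gt0 ?mulr_gt0 ?hsum_gt0.
move=> s; rewrite [LHS]/= ew refdivE -/k0.
under eq_bigr do rewrite kE.
rewrite big_split /= big_split /= prod_closed_factor //.
have -> : \prod_(i < nchild b w) (hsum s i.+1 / hsum s i) =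
          hsum s (nchild b w) / hsum s 0.
  rewrite -(big_mkord xpredT (fun i => hsum s i.+1 / hsum s i)).
  have [->|m_gt0] := posnP (nchild b w).
    by rewrite big_geq // divff // gt_eqF // hsum_gt0.
  by rewrite telescope_prodf // => i _; rewrite gt_eqF // hsum_gt0.
rewrite hsum0 hsum_last // csum_at_remove //.
rewrite [in RHS](bigID (fun z => ohead r != Some z)) /=.
rewrite [X in _ * (_ * (_ * X) * _)](_ : _ = q); last first.
  by apply: eq_bigr => z /andP[_ /negPn/eqP/cpar ->].
set P := \prod_(z | _ && (ohead r != Some z)) _.
have q0 := gt_eqF q_gt0; have h0 := gt_eqF (hsum_gt0 sq 0).
by field; rewrite q0 h0.
Qed.

End Step.

Lemma ratio_csum n w u r c eta :
  walk w = u :: r -> uniq (u :: r) -> is_node b w -> u \notin Lambda ->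
  coherent w (unvisited r) c eta -> eta w = None ->
  (forall z, ohead r = Some z -> c u z = o) -> (#|V| <= n + size w)%N ->
  exists2 K, 0 < K & forall s,
    Defs.ratio b Phi phi sq wlines n eta w s =
    K * csum_at e Phi phi (unvisited r) rho c u s.
Proof.
elim: n w u r c eta => [|n IHn] w u r c eta wE u_r nw uL coh ew cpar.
  rewrite add0n leqNgt => /negP[].
  by apply: walk_size_le; rewrite wE.
rewrite addSnnS => le_n; apply: ratio_step => // i s iN yU.
have eyu : e (nth v (kids (u :: r)) i) u.
  by have := mem_nth v iN; rewrite mem_kids e_sym => /andP[].
have yu : nth v (kids (u :: r)) i != u by apply: contraTneq eyu => ->; rewrite e_irr.
have wi : walk (rcons w i) = nth v (kids (u :: r)) i :: u :: r.
  by rewrite walk_rcons wE /walk_step u_r iN.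
have nwi : is_node b (rcons w i).
  by rewrite is_node_rcons nw (leq_trans iN) // -wE size_kids.
have [yL yr] : nth v (kids (u :: r)) i \notin Lambda /\ nth v (kids (u :: r)) i \notin r.
  by move: yU; rewrite inE => /andP.
have y_ur : nth v (kids (u :: r)) i \notin u :: r by rewrite inE negb_or yu.
have uU : u \in unvisited r by rewrite inE uL; case/andP: u_r.
apply: (IHn _ _ _ _ _ wi _ nwi yL) => //.
- by rewrite cons_uniq y_ur.
- exact: coherent_branch.
- have := coh i [::]; rewrite cats1 => /(_ nwi); rewrite /freeze_lines => ->.
  rewrite wi yU /wfrozen nwi wi (negbTE yL) (negbTE y_ur) /=.
  rewrite /wlines wi wE /= (inj_eq Some_inj) [u == _]eq_sym (negbTE yu).
  by rewrite !andbF.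
- move=> z [<-]; rewrite /branch_spins eqxx index_uniq ?kids_uniq ?eqxx //.
- by rewrite size_rcons.
Qed.

Lemma walk_tree_marginal s : v \notin Lambda ->
  tree_marginal b Phi phi sq wlines #|V| (frozen_on wfrozen (wspin o sq rho)) s =
  csum_at e Phi phi (~: Lambda) rho (fun _ z => rho z) v s /
  csum e Phi phi (~: Lambda) rho (fun _ z => rho z).
Proof.
move=> vL; have U0 : unvisited [::] = ~: Lambda.
  by apply/setP => z; rewrite !inE andbT.
have [||//||K K0 KE] := @ratio_csum #|V| [::] v [::] (fun _ z => rho z)
  (frozen_on wfrozen (wspin o sq rho)) erefl erefl erefl vL.
- move=> i q nx; rewrite /frozen_on /wspin /wfrozen nx U0 /=.
  case: (walk _) => [|z r] //; rewrite inE; case: (z \in Lambda) => //=.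
- by rewrite /frozen_on /wfrozen /= (negbTE vL).
- by rewrite addn0.
rewrite /tree_marginal (eq_bigr _ (fun l _ => KE l)) KE -mulr_sumr U0.
rewrite -csum_split -mulf_div divff ?mul1r // gt_eqF //.
Qed.

Lemma walk_tree_marginal_frozen s : v \in Lambda ->
  tree_marginal b Phi phi sq wlines #|V| (frozen_on wfrozen (wspin o sq rho)) s =
  (s == rho v)%:R.
Proof.
move=> vL; have e0 : frozen_on wfrozen (wspin o sq rho) [::] = Some (rho v).
  by rewrite /frozen_on /wfrozen /wspin /= vL.
rewrite /tree_marginal (eq_bigr _ (fun l _ => ratio_frozen _ _ l e0)).
have -> : \sum_l (l == rho v)%:R = 1 :> R.
  by rewrite -[RHS](sum_indic (fun=> 1) (rho v)); apply: eq_bigr => l _; rewrite mul1r.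
by rewrite (ratio_frozen _ _ _ e0) divr1.
Qed.

End Recursion.

End WalkTree.

Section GibbsMarginals.
Variables (R : realType) (X V : finType) (e : rel V).
Variables (Phi : X -> X -> R) (phi : X -> R).
Hypotheses (Phi_sym : forall s t, Phi s t = Phi t s)
  (Phi_ge0 : forall s t, 0 <= Phi s t) (phi_ge0 : forall s, 0 <= phi s).
Hypotheses (e_sym : symmetric e) (e_irr : irreflexive e).
Variables (Lambda : {set V}) (sigma : {ffun V -> X}).

Lemma weight_cweight c x : weight e Phi phi x = cweight e Phi phi [set: V]%SET c x.
Proof.
rewrite /weight /cweight [RHS](eq_bigl xpredT); last by move=> y; rewrite inE.
rewrite [RHS]big_split mulrC; congr (_ * _).
rewrite -(pair_big_dep xpredT (fun y z => e y z && (enum_rank y < enum_rank z)%N)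
  (fun y z => Phi (x y) (x z))) /=.
by apply: eq_bigr => y _; rewrite big_mkcondr; apply: eq_bigr => z _; rewrite inE.
Qed.

Lemma weight_boundary : exists C : R, forall x, agree Lambda sigma x ->
  weight e Phi phi x = C * cweight e Phi phi (~: Lambda) (fun _ z => sigma z) x.
Proof.
have [n] := ubnP #|Lambda|; elim: n Lambda => // n IHn L; rewrite ltnS => leLn.
have [->|/set0Pn[u uL]] := eqVneq L finset.set0.
  by exists 1 => x _; rewrite mul1r finset.setC0; apply: weight_cweight.
have LE : ~: L = ~: (L :\ u) :\ u.
  by apply/setP => z; rewrite !inE; case: eqP => // ->; rewrite uL.
have [|C CE] := IHn (L :\ u).
  by move: leLn; rewrite (cardsD1 u L) uL.
exists (C * (phi (sigma u) * \prod_(z | e u z && (z \notin ~: (L :\ u)))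
                               Phi (sigma u) (sigma z))).
move=> x /forall_inP agx; rewrite CE; last first.
  by apply/forall_inP => z; rewrite !inE => /andP[_ /agx].
rewrite (@cweight_remove _ _ _ e Phi phi Phi_sym e_sym e_irr _ _
          (fun _ z => sigma z) _ u) //.
- by rewrite -LE (eqP (agx u uL)) mulrA.
- by rewrite !inE eqxx.
- by move=> y _ _; rewrite (eqP (agx u uL)).
Qed.

Hypothesis agree_gt0 : 0 < gibbs_prob e Phi phi (agree Lambda sigma).

Let Z := csum e Phi phi (~: Lambda) sigma (fun _ z => sigma z).

Lemma gibbs_probE P : gibbs_prob e Phi phi P =
  (\sum_(x | P x) weight e Phi phi x) / \sum_y weight e Phi phi y.
Proof. by rewrite /gibbs_prob /gibbs mulr_suml. Qed.

Lemma csum_boundary_gt0 : 0 < Z.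
Proof.
rewrite lt_def sumr_ge0 ?andbT => [|x _]; last exact: cweight_ge0.
have [C CE] := weight_boundary; apply: contraTneq agree_gt0 => Z0.
have ZE : \sum_(x | agree Lambda sigma x) weight e Phi phi x = C * Z.
  by rewrite (eq_bigr _ CE) -mulr_sumr /Z /csum finset.setCK.
by rewrite gibbs_probE ZE Z0 mulr0 mul0r ltxx.
Qed.

Lemma graph_marginalE v s :
  graph_marginal e Phi phi v s Lambda sigma =
  csum_at e Phi phi (~: Lambda) sigma (fun _ z => sigma z) v s / Z.
Proof.
have [C CE] := weight_boundary.
have ZE : \sum_(x | agree Lambda sigma x) weight e Phi phi x = C * Z.
  by rewrite (eq_bigr _ CE) -mulr_sumr /Z /csum finset.setCK.
have := agree_gt0; rewrite /graph_marginal !gibbs_probE ZE.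
set T := \sum_y _; move=> /gt_eqF; rewrite !mulf_eq0 invr_eq0.
case/norP => /norP[C0 Z0] T0.
have -> : \sum_(x | agree Lambda sigma x && (x v == s)) weight e Phi phi x =
          C * csum_at e Phi phi (~: Lambda) sigma (fun _ z => sigma z) v s.
  rewrite /csum_at finset.setCK mulr_sumr.
  by apply: eq_bigr => x /andP[/CE].
by field; rewrite C0 Z0 T0.
Qed.

Lemma graph_marginal_frozen v s : v \in Lambda ->
  graph_marginal e Phi phi v s Lambda sigma = (s == sigma v)%:R.
Proof.
move=> vL; rewrite /graph_marginal; have [->|ne] := eqVneq s (sigma v).
  rewrite /gibbs_prob [X in X / _](eq_bigl (agree Lambda sigma)) ?divff ?gt_eqF //.
  move=> x; apply: andb_idr => /forall_inP/(_ v vL) //.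
rewrite /gibbs_prob big_pred0 ?mul0r // => x; apply/negbTE/negP.
by move=> /andP[/forall_inP/(_ v vL)/eqP ->]; rewrite eq_sym (negbTE ne).
Qed.

End GibbsMarginals.

Section PermissiveLimit.
Variables (R : realType) (X V : finType) (e : rel V).
Variables (Phi : X -> X -> R) (phi : X -> R) (c2 : R).
Variables (Lambda : {set V}) (sigma : {ffun V -> X}).

Definition lift_spins (x : {ffun V -> X}) : {ffun V -> option X} :=
  [ffun y => Some (x y)].

Let rho := lift_spins sigma.

Lemma cvg_cweight (U : {set V}) c x :
  (cweight e (ext_Phi Phi c2) (ext_phi phi c3) U c x @[c3 --> 0^'+] -->
   cweight e (ext_Phi Phi c2) (ext_phi phi 0) U c x)%classic.
Proof.
apply: cvg_big => [p|y yU]; first exact: mul_continuous.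
apply: cvgMl; rewrite /ext_phi; case: (x y) => [s|]; first exact: cvg_cst.
apply: cvg_at_right_filter; exact: cvg_id.
Qed.

Lemma cvg_csum (U : {set V}) tau c :
  (csum e (ext_Phi Phi c2) (ext_phi phi c3) U tau c @[c3 --> 0^'+] -->
   csum e (ext_Phi Phi c2) (ext_phi phi 0) U tau c)%classic.
Proof.
by apply: cvg_big => [p|x _]; [exact: add_continuous|exact: cvg_cweight].
Qed.

Lemma cvg_csum_at (U : {set V}) tau c u s :
  (csum_at e (ext_Phi Phi c2) (ext_phi phi c3) U tau c u s @[c3 --> 0^'+] -->
   csum_at e (ext_Phi Phi c2) (ext_phi phi 0) U tau c u s)%classic.
Proof.
by apply: cvg_big => [p|x _]; [exact: add_continuous|exact: cvg_cweight].
Qed.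

(* At [c3 = 0] a configuration using the permissive spin on [U] has weight 0. *)
Lemma ext_sum0 (U : {set V}) c (P : pred {ffun V -> option X}) :
  (forall x, P x -> agree (~: U) rho x) ->
  \sum_(x | P x)
     cweight e (ext_Phi Phi c2) (ext_phi phi 0) U (fun y z => Some (c y z)) x =
  \sum_(x | P (lift_spins x)) cweight e Phi phi U c x.
Proof.
move=> Prho; rewrite (bigID (fun x : {ffun V -> option X} => [exists y in U, x y == None])) /=.
rewrite big1 ?add0r; last first.
  move=> x /andP[_ /exists_inP[y yU /eqP xy]].
  by rewrite /cweight (bigD1 y yU) /= xy /= !mul0r.
rewrite (reindex_onto lift_spins (fun x : {ffun V -> option X} => [ffun y => odflt (sigma y) (x y)])) /=.
  apply: eq_big => [x|x _].
    rewrite [X in _ && X](_ : _ = true) ?andbT; last first.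
      by apply/eqP/ffunP => y; rewrite !ffunE.
    rewrite andb_idr // => _; apply/exists_inPn => y _.
    by rewrite ffunE.
  rewrite /cweight; apply: eq_bigr => y yU; rewrite !ffunE; congr (_ * _).
  by apply: eq_bigr => z _; rewrite !ffunE.
move=> x /andP[/Prho/forall_inP agx /exists_inPn nx].
apply/ffunP => y; rewrite !ffunE.
have [yU|yU] := boolP (y \in U); first by case: (x y) (nx y yU).
by have := agx y; rewrite inE yU => /(_ isT)/eqP ->; rewrite ffunE.
Qed.

Hypotheses (Phi_sym : forall s t, Phi s t = Phi t s)
  (Phi_ge0 : forall s t, 0 <= Phi s t) (phi_ge0 : forall s, 0 <= phi s).
Hypotheses (e_sym : symmetric e) (e_irr : irreflexive e).
Hypothesis agree_gt0 : 0 < gibbs_prob e Phi phi (agree Lambda sigma).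

Lemma agree_lift L x : agree L rho (lift_spins x) = agree L sigma x.
Proof. by apply: eq_forallb => y; rewrite !ffunE. Qed.

Lemma cvg_graph_marginal v s :
  (csum_at e (ext_Phi Phi c2) (ext_phi phi c3) (~: Lambda) rho
     (fun _ z => rho z) v (Some s) /
   csum e (ext_Phi Phi c2) (ext_phi phi c3) (~: Lambda) rho (fun _ z => rho z)
     @[c3 --> 0^'+] --> graph_marginal e Phi phi v s Lambda sigma)%classic.
Proof.
have rhoE : (fun (_ : V) z => rho z) = (fun _ z => Some (sigma z)).
  by apply/funext => y; apply/funext => z; rewrite ffunE.
have at0 : csum_at e (ext_Phi Phi c2) (ext_phi phi 0) (~: Lambda) rho
     (fun _ z => rho z) v (Some s) =
    csum_at e Phi phi (~: Lambda) sigma (fun _ z => sigma z) v s.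
  rewrite rhoE /csum_at ext_sum0 => [|x /andP[] //].
  by apply: eq_bigl => x; rewrite agree_lift ffunE.
have tot0 : csum e (ext_Phi Phi c2) (ext_phi phi 0) (~: Lambda) rho
     (fun _ z => rho z) = csum e Phi phi (~: Lambda) sigma (fun _ z => sigma z).
  rewrite rhoE /csum ext_sum0 => [|x //].
  by apply: eq_bigl => x; rewrite agree_lift.
rewrite graph_marginalE // -at0 -tot0.
apply: cvgM; first exact: cvg_csum_at.
by apply: cvgV; [rewrite tot0 gt_eqF // csum_boundary_gt0 | exact: cvg_csum].
Qed.

End PermissiveLimit.

(* The weight c3 of the permissive spin is arbitrary in the hypothesis: for one
   fixed large c3 that spin dominates and the tree mixes whatever Phi is. *)
Theorem theorem3p10 (R : realType) (X : finType) (sq : X)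
    (Phi : X -> X -> R) (phi : X -> R) (c2 : R) (delta : nat -> R) (b : nat)
    (Phi_sym : forall s t, Phi s t = Phi t s)
    (Phi_ge0 : forall s t, 0 <= Phi s t)
    (phi_ge0 : forall s, 0 <= phi s)
    (c2_gt0 : 0 < c2)
    (delta_rate : is_rate delta)
    (b_gt0 : (0 < b)%N)
    (tree_vssm : forall c3 : R, 0 < c3 ->
       vssm b (ext_Phi Phi c2) (ext_phi phi c3) (Some sq) delta) :
  forall (V : finType) (e : rel V), symmetric e -> irreflexive e ->
    (maxdeg e <= b.+1)%N -> ssm e Phi phi delta.
Proof.
move=> V e e_sym e_irr e_deg s v Lambda sigma tau d sigma_gt0 tau_gt0 dist.
have ext_sym (a a' : option X) : ext_Phi Phi c2 a a' = ext_Phi Phi c2 a' a.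
  by case: a a' => [?|] [?|] //; apply: Phi_sym.
have ext_ge0 (a a' : option X) : 0 <= ext_Phi Phi c2 a a'.
  by case: a a' => [?|] [?|] /=; rewrite /ext_Phi ?Phi_ge0 ?ltW.
have ext_phi_ge0 c3 (c3_gt0 : 0 < c3) (a : option X) : 0 <= ext_phi phi c3 a.
  by case: a => [?|]; rewrite /ext_phi ?phi_ge0 ?ltW.
have ext_None (a : option X) : ext_Phi Phi c2 a None = c2 by case: a.
pose spin rho := wspin e v Lambda None (Some sq) (lift_spins rho).
have tdist : is_dist (fun k => exists w,
    [/\ wfrozen e b v Lambda w, spin sigma w != spin tau w & size w = k]) d.
  apply: wspin_dist => //; move: dist; congr is_dist; apply/funext => n.
  by apply/propext; split=> -[p [? ? ? ne]]; exists p; split; rewrite ?ffunE // in ne *.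
have mixing c3 : 0 < c3 ->
    `|tree_marginal b (ext_Phi Phi c2) (ext_phi phi c3) (Some sq)
        (wlines e b v Lambda) #|V|
        (frozen_on (wfrozen e b v Lambda) (spin sigma)) (Some s) -
      tree_marginal b (ext_Phi Phi c2) (ext_phi phi c3) (Some sq)
        (wlines e b v Lambda) #|V|
        (frozen_on (wfrozen e b v Lambda) (spin tau)) (Some s)|
    <= rate_at delta d.
  move=> c3_gt0; apply: (tree_vssm c3 c3_gt0 _ _ _ _ _ _ _ _ _ _ tdist).
  - exact: valid_wlines.
  - by move=> w /andP[].
  - exact: wpruned_height.
have [vL|vL] := boolP (v \in Lambda).
  have := mixing 1 ltr01; rewrite !walk_tree_marginal_frozen // !ffunE.
  by rewrite !graph_marginal_frozen.
pose M (rho : {ffun V -> X}) c3 :=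
  csum_at e (ext_Phi Phi c2) (ext_phi phi c3) (~: Lambda) (lift_spins rho)
    (fun _ z => lift_spins rho z) v (Some s) /
  csum e (ext_Phi Phi c2) (ext_phi phi c3) (~: Lambda) (lift_spins rho)
    (fun _ z => lift_spins rho z).
have M_cvg : (`|M sigma c3 - M tau c3| @[c3 --> 0^'+] -->
    `|graph_marginal e Phi phi v s Lambda sigma -
      graph_marginal e Phi phi v s Lambda tau|)%classic.
  by apply: cvg_norm; apply: cvgB; apply: cvg_graph_marginal.
apply: (cvgr_to_le M_cvg).
near=> c3.
have c3_gt0 : 0 < c3 by near: c3; exact: nbhs_right_gt.
have := mixing _ c3_gt0.
rewrite !(@walk_tree_marginal _ _ _ _ _ e_sym e_irr e_deg _ _ _ _ _ _ c2) //.
  exact: ext_phi_ge0.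
exact: ext_phi_ge0.
Unshelve. all: by end_near.
Qed.
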